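(* Let $(R^k,\mu^k(1;x))$ be the dehomogenized output of the DD algorithm (defined in the context) at iteration $k$, applied to $\bar A=\begin{pmatrix} b & -A\end{pmatrix}$. Let $\bar k$ be the minimum index at which $P^{\bar k}=K^{\bar k}\cap\{(x_0;x)\mid x_0=1\}$ is bounded, so that, for $k\ge\bar k$, $R^k_{0,j}=1$ for all $j\in\{1,\dots,p_k\}$. For each $k\in\{\bar k,\dots,m\}$, the following problem is a relaxation of $(\mathrm D)$: $$(\mathrm{DDR}^k)\quad \min\ \sum_{i=1}^{p_k}\tilde f\bigl(R^k_{[1:n],i}\,\mu^k_i(1;x),\ y\,\mu^k_i(1;x),\ \mu^k_i(1;x)\bigr)$$ $$\text{s.t. } y\mu^k_i(1;x)\in\mu^k_i(1;x)\,C,\quad \mu^k_i(1;x)\ge 0\quad (i=1,\dots,p_k),\qquad R^k\mu^k(1;x)=(1;x).$$ Let $\underline{\mathrm{DDR}}^k$ be obtained from $(\mathrm{DDR}^k)$ by replacing $\mu^k(1;x)$ with a variable $\lambda^k\in\mathbb R^{p_k}$ and each $y\mu^k_i(1;x)$ with a variable $y^{k,i}\in\mathbb R^{n_y}$. That is, $\underline{\mathrm{DDR}}^k$ minimizes $\sum_{i=1}^{p_k}\tilde f(R^k_{[1:n],i}\lambda^k_i,y^{k,i},\lambda^k_i)$ subject to $y^{k,i}\in\lambda^k_iC$ and $\lambda^k_i\ge0$ for all $i$, and $R^k\lambda^k=(1;x)$. Then $\underline{\mathrm{DDR}}^k$ is a convex optimization problem that relaxes $(\mathrm{DDR}^k)$,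 and $$\mathrm{opt}_{\underline{\mathrm{DDR}}^{\bar k}}\le\cdots\le \mathrm{opt}_{\underline{\mathrm{DDR}}^{m}}=\mathrm{opt}_{\mathrm D}.$$
   Context: Problem: $(\mathrm D)$: $\mathrm{opt}_{\mathrm D}=\min\{f(x,y)\mid y\in C,\ x\in P\}$, where $C\subset\mathbb R^{n_y}$ is a nonempty compact convex set, $P=\{x\in\mathbb R^n\mid Ax\le b\}$ is a nonempty polytope with $A\in\mathbb R^{m\times n}$, $b\in\mathbb R^m$, and $f:\mathbb R^n\times\mathbb R^{n_y}\to\mathbb R$ is continuous, concave in $x$ for each fixed $y$ and convex in $y$ for each fixed $x$. Homogenization: $\tilde f(x,y,\lambda)=\lambda f(x/\lambda,y/\lambda)$ for $\lambda>0$ and $\tilde f(0,0,0)=0$. Also $0C=\{0\}$. For a problem $(Q)$, $\mathrm{opt}_Q$ is its optimal value. A relaxation of a minimization problem is one in which each feasible point of the original yields a feasible point with objective value no larger. DD algorithm. Input $\bar A\in\mathbb R^{m\times(n+1)}$ with rows $\bar A_{1,:},\dots,\bar A_{m,:}$. Coordinates of $\mathbb R^{n+1}$ are indexed $0,\dots,n$; points are written $(x_0;x)$; $e_0,\dots,e_n$ are the unit vectors. Let $K^k=\{(x_0;x)\mid x_0\ge0,\ \bar A_{i,:}(x_0;x)\ge0,\ i=1,\dots,k\}$. The algorithm produces matrices $R^k$ ($p_k$ columns) and $L^k$ ($q_k$ columns) with $n+1$ rows, and vectors of functions $\mu^k$ (length $p_k$) and $\theta^k$ (length $q_k$) of $(x_0;x)$.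 Initialization: $L^0=(e_1,\dots,e_n)$, $\theta^0=x$, $R^0=(e_0)$, $\mu^0=(x_0)$. Iteration $k=1,\dots,m$: write $L,\theta,R,\mu,p,q$ for $L^{k-1},\theta^{k-1},R^{k-1},\mu^{k-1},p_{k-1},q_{k-1}$, and set $\alpha=\bar A_{k,:}L$, $\beta=\bar A_{k,:}R$. Case 1 ($q>0$ and $\alpha\ne0$): let $\xi=\min\{i\mid\alpha_i\neq0\}$; if $\alpha_\xi<0$ replace (in place) $L_{:,\xi},\theta_\xi,\alpha_\xi$ by their negatives. Set $\mu^k=\bigl(\theta_\xi+\sum_{j=\xi+1}^{q}\alpha_j\theta_j/\alpha_\xi+\sum_{j=1}^{p}\beta_j\mu_j/\alpha_\xi,\ (\mu_j/\alpha_\xi)_{j=1}^{p}\bigr)$, $\theta^k=\bigl((\theta_j)_{j<\xi},(\theta_j/\alpha_\xi)_{j>\xi}\bigr)$, $R^k=\bigl(L_{:,\xi},(\alpha_\xi R_{:,j}-\beta_jL_{:,\xi})_{j=1}^{p}\bigr)$, $L^k=\bigl((L_{:,j})_{j<\xi},(\alpha_\xi L_{:,j}-\alpha_jL_{:,\xi})_{j>\xi}\bigr)$. Case 2 (otherwise): let $N^-,N^0,N^+$ be the sets of $i$ with $\beta_i<0$, $=0$, $>0$, and $N_{\rm tot}=\sum_{i\in N^+}\mu_i\beta_i$. Set $\mu^k=\bigl(\mu_{N^0},(\mu_i+\sum_{j\in N^-}\mu_j\mu_i\beta_j/N_{\rm tot})_{i\in N^+},(\mu_j\mu_i/N_{\rm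 tot})_{i\in N^+,j\in N^-}\bigr)$, $R^k=\bigl(R_{:,N^0},R_{:,N^+},(\beta_iR_{:,j}-\beta_jR_{:,i})_{i\in N^+,j\in N^-}\bigr)$, $\theta^k=\theta$, $L^k=L$. When functions are evaluated at a point of $K^k$ where some $N_{\rm tot}$ vanishes, quotients with that $N_{\rm tot}$ as denominator are given the value $0$. Dehomogenization: for each column $j$ with $R^k_{0,j}>0$, replace $R^k_{:,j}$ by $R^k_{:,j}/R^k_{0,j}$ and $\mu^k_j(1;x)$ by $R^k_{0,j}\mu^k_j(1;x)$; other columns are unchanged. $R^k_{[1:n],i}$ denotes the $i$th column without its entry in row $0$. *)

(* Defs.v *)
From HB Require Import structures.
From mathcomp Require Export all_boot all_order all_algebra.
From mathcomp Require Export all_classical all_reals all_analysis.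
Export Order.TTheory GRing.Theory Num.Theory.
Export numFieldNormedType.Exports.

Set Implicit Arguments.
Unset Strict Implicit.
Unset Printing Implicit Defensive.

Local Open Scope classical_set_scope.
Local Open Scope ring_scope.

(* Minimization problems over decision variables of type V.  The objective is
   a total function, but only its values on the feasible set matter. *)
Record problem (R : realType) (V : Type) := Problem {
  feasible : set V;
  objective : V -> R }.

(* The value is +oo for an infeasible and -oo for an unbounded problem. *)
Definition opt (R : realType) (V : Type) (Q : problem R V) : \bar R :=
  ereal_inf [set (objective Q v)%:E | v in feasible Q].

Definition relaxes (R : realType) (V W : Type)
    (Q' : problem R V) (Q : problem R W) : Prop :=
  forall w, feasible Q w ->
    exists2 v, feasible Q' v & objective Q' v <= objective Q w.

Definition convex_problem (R : realType) (V : lmodType R) (Q : problem R V) :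
    Prop :=
  convex_set (feasible Q) /\ convex_function (feasible Q) (objective Q).

(* The homogenization l f(x/l, y/l); it is meaningful for l > 0 and at
   (0, 0, 0), where it is 0.  The value 0 elsewhere is a dummy. *)
Definition homogenization (R : realType) (n ny : nat)
    (f : 'cV[R]_n * 'cV[R]_ny -> R) (x : 'cV[R]_n) (y : 'cV[R]_ny) (l : R) : R :=
  if 0 < l then l * f (l^-1 *: x, l^-1 *: y) else 0.

Definition scale_set (R : realType) (n : nat) (l : R) (C : set 'cV[R]_n) :
    set 'cV[R]_n := [set l *: c | c in C].

Definition polyhedron (R : realType) (m n : nat)
    (A : 'M[R]_(m, n)) (b : 'cV[R]_m) : set 'cV[R]_n :=
  [set x | forall i, (A *m x) i 0 <= b i 0].

Definition problemD (R : realType) (m n ny : nat)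
    (A : 'M[R]_(m, n)) (b : 'cV[R]_m) (C : set 'cV[R]_ny)
    (f : 'cV[R]_n * 'cV[R]_ny -> R) : problem R ('cV[R]_n * 'cV[R]_ny) :=
  Problem [set xy | C xy.2 /\ polyhedron A b xy.1] f.

(* The point (1; x); row 0 of a vector in 'cV_(1 + n) is the homogenizing
   coordinate. *)
Definition homog (R : realType) (n : nat) (x : 'cV[R]_n) : 'cV[R]_(1 + n) :=
  col_mx 1 x.

Section DoubleDescription.
Context (R : realType) (n : nat).

(* A column of R^k or L^k together with the entry of mu^k or theta^k that has
   the same index, as a function of (x_0; x). *)
Definition generator : Type := ('cV[R]_(1 + n) * ('cV[R]_(1 + n) -> R))%type.
Implicit Type z : 'cV[R]_(1 + n).

Record dd_state := DDState {
  lines : seq generator;   (* (L^k, theta^k) *)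
  rays : seq generator }.  (* (R^k, mu^k) *)

Definition dd_init : dd_state := DDState
  [seq (delta_mx (rshift 1 i) 0, fun z => z (rshift 1 i) 0) : generator
  | i <- enum 'I_n]
  [:: (delta_mx 0 0, fun z => z 0 0)].

Definition rowdot (a : 'rV[R]_(1 + n)) (v : 'cV[R]_(1 + n)) : R :=
  (a *m v) 0 0.

(* L is split as pre ++ g0 :: post, where g0 is the first line not orthogonal
   to a. *)
Definition dd_case1 (a : 'rV[R]_(1 + n)) (pre : seq generator)
    (g0 : generator) (post rs : seq generator) : dd_state :=
  let g : generator :=
    if rowdot a g0.1 < 0 then (- g0.1, fun z => - g0.2 z) else g0 in
  let al := rowdot a g.1 in
  DDState
    (pre ++ [seq (al *: h.1 - rowdot a h.1 *: g.1, fun z => h.2 z / al)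
            | h <- post])
    ((g.1, fun z => g.2 z + \sum_(h <- post) rowdot a h.1 * h.2 z / al
                          + \sum_(r <- rs) rowdot a r.1 * r.2 z / al)
     :: [seq (al *: r.1 - rowdot a r.1 *: g.1, fun z => r.2 z / al)
        | r <- rs]).

(* Since t / 0 = 0 in a field, the quotients by Ntot z are 0 whenever
   Ntot z = 0. *)
Definition dd_case2 (a : 'rV[R]_(1 + n)) (ls rs : seq generator) : dd_state :=
  let N0 := [seq r <- rs | rowdot a r.1 == 0] in
  let Np := [seq r <- rs | 0 < rowdot a r.1] in
  let Nm := [seq r <- rs | rowdot a r.1 < 0] in
  let Ntot z := \sum_(i <- Np) i.2 z * rowdot a i.1 in
  DDState ls
    (N0
     ++ [seq (i.1, fun z => i.2 z
               + \sum_(j <- Nm) j.2 z * i.2 z * rowdot a j.1 / Ntot z)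
        | i <- Np]
     ++ [seq (rowdot a i.1 *: j.1 - rowdot a j.1 *: i.1,
              fun z => j.2 z * i.2 z / Ntot z)
        | i <- Np, j <- Nm]).

Definition dd_step (a : 'rV[R]_(1 + n)) (s : dd_state) : dd_state :=
  let xi := find (fun h : generator => rowdot a h.1 != 0) (lines s) in
  match drop xi (lines s) with
  | g0 :: post => dd_case1 a (take xi (lines s)) g0 post (rays s)
  | [::] => dd_case2 a (lines s) (rays s)
  end.

(* The state after iteration k, for k <= m. *)
Definition dd (m : nat) (Ab : 'M[R]_(m, 1 + n)) (k : nat) : dd_state :=
  foldl (fun s i => dd_step (row i Ab) s) dd_init (take k (enum 'I_m)).

Definition dehomogenize (r : generator) : generator :=
  if 0 < r.1 0 0 then ((r.1 0 0)^-1 *: r.1, fun z => r.1 0 0 * r.2 z) else r.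

Definition dd_cone (m : nat) (Ab : 'M[R]_(m, 1 + n)) (k : nat) :
    set 'cV[R]_(1 + n) :=
  [set z : 'cV[R]_(1 + n) | 0 <= z 0 0 /\
     forall i : 'I_m, (i < k)%N -> 0 <= (Ab *m z) i 0].

End DoubleDescription.

Section DDRelaxation.
Context (R : realType) (m n ny : nat).
Variables (A : 'M[R]_(m, n)) (b : 'cV[R]_m).

Definition Abar : 'M[R]_(m, 1 + n) := row_mx b (- A).

Definition Pk (k : nat) : set 'cV[R]_(1 + n) :=
  dd_cone Abar k `&` [set z : 'cV[R]_(1 + n) | z 0 0 = 1].

Definition first_bounded (k : nat) : Prop :=
  [/\ (k <= m)%N, bounded_set (Pk k) &
      forall j, (j < k)%N -> ~ bounded_set (Pk j)].

Definition dd_out (k : nat) : seq (generator R n) :=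
  [seq dehomogenize r | r <- rays (dd Abar k)].

Definition pk (k : nat) : nat := size (dd_out k).

Definition Rk (k : nat) : 'M[R]_(1 + n, pk k) :=
  \matrix_(i, j) (tnth (in_tuple (dd_out k)) j).1 i 0.

Definition muk (k : nat) (x : 'cV[R]_n) : 'cV[R]_(pk k) :=
  \col_j (tnth (in_tuple (dd_out k)) j).2 (homog x).

Variables (C : set 'cV[R]_ny) (f : 'cV[R]_n * 'cV[R]_ny -> R).

(* The decision variables are (x, y). *)
Definition DDR (k : nat) : problem R ('cV[R]_n * 'cV[R]_ny) :=
  Problem
    [set xy | let mu := muk k xy.1 in
      (forall i, scale_set (mu i 0) C (mu i 0 *: xy.2) /\ 0 <= mu i 0) /\
      Rk k *m mu = homog xy.1]
    (fun xy => let mu := muk k xy.1 in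
      \sum_i homogenization f
        (mu i 0 *: dsubmx (col i (Rk k))) (mu i 0 *: xy.2) (mu i 0)).

(* The decision variables are (x, Y, lambda); column i of Y is y^{k,i}. *)
Definition uDDR (k : nat) :
    problem R ('cV[R]_n * 'M[R]_(ny, pk k) * 'cV[R]_(pk k)) :=
  Problem
    [set v : 'cV[R]_n * 'M[R]_(ny, pk k) * 'cV[R]_(pk k) |
      let: (x, Y, lambda) := v in
      (forall i, scale_set (lambda i 0) C (col i Y) /\ 0 <= lambda i 0) /\
      Rk k *m lambda = homog x]
    (fun v => let: (x, Y, lambda) := v in
      \sum_i homogenization f
        (lambda i 0 *: dsubmx (col i (Rk k))) (col i Y) (lambda i 0)).

End DDRelaxation.

(* Main.v *)
Require Import Defs.
From mathcomp Require Import ring.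

Set Implicit Arguments.
Unset Strict Implicit.
Unset Printing Implicit Defensive.

Local Open Scope classical_set_scope.
Local Open Scope ring_scope.

(** Two ingredients carry the proof: an invariant of the double description
    algorithm, and Jensen's inequality for perspectives.

    The invariant [dd_valid]: after each iteration the lines are orthogonal to
    the constraints met so far, each ray lies in the cone K that they cut out
    and makes one of them strictly positive, and every z in K equals
    L theta(z) + R mu(z) with mu(z) >= 0 ([dd_valid_step], [dd_validP]).
    Once P^k is bounded, and since it contains the nonempty P, the only vector
    of K with coordinate 0 equal to 0 is the null vector ([recession0]).
    Hence all lines vanish and all rays, being nonzero, have a positive
    coordinate 0: the dehomogenized columns of R^k are points of P^k
    ([Rk0], [colRk_Pk]), and mu^k(1;x) is a vector of convex weights which
    writes x in P as a combination of them ([muk_ge0], [Rk_muk]).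

    That (DDR^k) relaxes (D) is then Jensen's inequality for f(-, y), which is
    concave. The underlined problem depends on R^k only; it is studied for an
    arbitrary matrix M in place of R^k, under the name [lifted M]. Its objective
    is a sum of perspectives of the convex functions f(r_i, -), hence convex
    ([lifted_convex]); substituting mu^k(1;x) for lambda shows that it relaxes
    (DDR^k).

    Since all lines vanish from kbar on, each later iteration falls in Case 2
    and R^{k+1} = R^k W for some W >= 0 ([Rk_refine]), whose column sums are 1
    because row 0 of both matrices is constantly 1.
    Aggregating lambda and Y by W turns a feasible point for R^{k+1} into one
    for R^k; convexity in y and concavity in x show that the objective does not
    increase ([lifted_refine]), whence the monotonicity of the optimal values.
    At k = m the columns of R^m are points of P, so the objective is a convex
    combination of values of f on P x C, one of which is at most the objective
    ([lifted_exact]); thus (D) in turn relaxes the last problem. *)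

(** * Perspectives of convex functions *)

Section Perspective.
Context (R : realType) (V : lmodType R).
Implicit Types (g : V -> R) (y : V) (l : R).

Lemma convex_setP (S : set V) (x y : V) (t : R) : convex_set S ->
  0 <= t <= 1 -> S x -> S y -> S (t *: x + (1 - t) *: y).
Proof.
move=> cS /andP[t0 t1] Sx Sy.
by have := cS x y (Itv01 t0 t1); rewrite !inE; apply.
Qed.

Lemma convex_functionP g (x y : V) (t : R) : convex_function setT g ->
  0 <= t <= 1 -> g (t *: x + (1 - t) *: y) <= t * g x + (1 - t) * g y.
Proof.
by move=> cg /andP[t0 t1]; apply: (cg (Itv01 t0 t1) x y); rewrite inE.
Qed.

(** The perspective [l * g (y / l)] of [g], with the dummy value 0 for
    [l <= 0]. *)
Definition persp g y l : R := if 0 < l then l * g (l^-1 *: y) else 0.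

(** The pairs [(y, l)] on which the perspective is meaningful: [l > 0], or
    [y = 0] and [l = 0]. *)
Definition persp_dom y l : Prop := 0 <= l /\ (l = 0 -> y = 0).

Lemma persp0 g y : persp g y 0 = 0.
Proof. by rewrite /persp ltxx. Qed.

Lemma persp1 g y : persp g y 1 = g y.
Proof. by rewrite /persp ltr01 invr1 scale1r mul1r. Qed.

Lemma persp_line g y l : 0 <= l -> persp g (l *: y) l = l * g y.
Proof.
rewrite /persp le_eqVlt => /predU1P[<-|l0]; first by rewrite ltxx mul0r.
by rewrite l0 scalerA mulVf ?scale1r // gt_eqF.
Qed.

Lemma perspZ g y l t : 0 <= t -> persp g (t *: y) (t * l) = t * persp g y l.
Proof.
rewrite le_eqVlt => /predU1P[<-|t0]; first by rewrite !mul0r persp0.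
rewrite /persp pmulr_rgt0 //; case: ifP => l0; last by rewrite mulr0.
have -> : (t * l)^-1 *: (t *: y) = l^-1 *: y.
  by rewrite scalerA invfM [_ * t]mulrAC mulVf ?mul1r // gt_eqF.
by rewrite mulrA.
Qed.

Lemma persp_dom_add y1 y2 l1 l2 :
  persp_dom y1 l1 -> persp_dom y2 l2 -> persp_dom (y1 + y2) (l1 + l2).
Proof.
move=> [l1_ge0 y1E] [l2_ge0 y2E]; split; first exact: addr_ge0.
by move/eqP; rewrite paddr_eq0 // => /andP[/eqP/y1E-> /eqP/y2E->]; rewrite addr0.
Qed.

(** The perspective of a convex function is sublinear: with [perspZ], this is
    its convexity. *)
Lemma persp_add g y1 y2 l1 l2 : convex_function setT g ->
  persp_dom y1 l1 -> persp_dom y2 l2 ->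
  persp g (y1 + y2) (l1 + l2) <= persp g y1 l1 + persp g y2 l2.
Proof.
move=> cg [l1_ge0 y1E] [l2_ge0 y2E].
have [l1E|l1n0] := eqVneq l1 0; first by rewrite l1E y1E // !add0r persp0 add0r.
have [l2E|l2n0] := eqVneq l2 0; first by rewrite l2E y2E // !addr0 persp0 addr0.
have l1_gt0 : 0 < l1 by rewrite lt_neqAle eq_sym l1n0.
have l2_gt0 : 0 < l2 by rewrite lt_neqAle eq_sym l2n0.
have l_gt0 : 0 < l1 + l2 by rewrite addr_gt0.
have ln0 : l1 + l2 != 0 by rewrite gt_eqF.
rewrite /persp l_gt0 l1_gt0 l2_gt0.
have t01 : 0 <= l1 / (l1 + l2) <= 1.
  by rewrite divr_ge0 ?(ltW l1_gt0) ?(ltW l_gt0) //= ler_pdivrMr // mul1r lerDl ltW.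
have onemE : 1 - l1 / (l1 + l2) = l2 / (l1 + l2) by field.
have := convex_functionP (l1^-1 *: y1) (l2^-1 *: y2) cg t01.
rewrite onemE !scalerA.
rewrite [l1 / _ / _]mulrAC divff // [l2 / _ / _]mulrAC divff // mul1r -scalerDr.
rewrite -(ler_pM2l l_gt0) => /le_trans; apply.
by rewrite le_eqVlt; apply/orP; left; apply/eqP; field.
Qed.

Lemma persp_sum g (I : finType) (y : I -> V) (l : I -> R) :
  convex_function setT g -> (forall i, persp_dom (y i) (l i)) ->
  persp g (\sum_i y i) (\sum_i l i) <= \sum_i persp g (y i) (l i).
Proof.
move=> cg yl; suff [] : persp_dom (\sum_i y i) (\sum_i l i) /\
  persp g (\sum_i y i) (\sum_i l i) <= \sum_i persp g (y i) (l i) by [].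
elim: (index_enum I) => [|i s [dom_s le_s]].
  by rewrite !big_nil persp0.
rewrite !big_cons; split; first exact: persp_dom_add.
by rewrite (le_trans (persp_add cg (yl i) dom_s)) // lerD2l.
Qed.

(** Jensen's inequality, as the subadditivity of the perspective at total
    weight 1. *)
Lemma jensen g (I : finType) (w : I -> R) (y : I -> V) :
  convex_function setT g -> (forall i, 0 <= w i) -> \sum_i w i = 1 ->
  g (\sum_i w i *: y i) <= \sum_i w i * g (y i).
Proof.
move=> cg w_ge0 w1; rewrite -persp1 -w1.
under [leRHS]eq_bigr do rewrite -persp_line //.
by apply: persp_sum => // i; split=> // ->; rewrite scale0r.
Qed.

End Perspective.

Section ScaleSet.
Context (R : realType) (n : nat) (C : set 'cV[R]_n).
Implicit Types (y : 'cV[R]_n) (l : R).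

Lemma scale_set_dom y l : scale_set l C y -> 0 <= l -> persp_dom y l.
Proof. by case=> c _ <- l0; split=> // ->; rewrite scale0r. Qed.

Lemma scale_setZ t y l : scale_set l C y -> scale_set (t * l) C (t *: y).
Proof. by case=> c Cc <-; exists c => //; rewrite scalerA. Qed.

Hypothesis C_convex : convex_set C.

Lemma scale_set_add y1 y2 l1 l2 : 0 <= l1 -> 0 <= l2 ->
  scale_set l1 C y1 -> scale_set l2 C y2 -> scale_set (l1 + l2) C (y1 + y2).
Proof.
rewrite le_eqVlt => /predU1P[<- _|l1_gt0].
  by case=> c _ <-; rewrite scale0r !add0r.
move=> l2_ge0 [c1 Cc1 <-] [c2 Cc2 <-].
have l_gt0 : 0 < l1 + l2 by rewrite ltr_wpDr.
have ln0 : l1 + l2 != 0 by rewrite gt_eqF.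
exists (l1 / (l1 + l2) *: c1 + (1 - l1 / (l1 + l2)) *: c2).
  apply: convex_setP => //.
  by rewrite divr_ge0 ?(ltW l1_gt0) ?(ltW l_gt0) //= ler_pdivrMr // mul1r lerDl.
by rewrite scalerDr !scalerA; congr (_ *: _ + _ *: _); field.
Qed.

Lemma scale_set_sum (I : finType) (y : I -> 'cV[R]_n) (l : I -> R) :
  C !=set0 -> (forall i, 0 <= l i) -> (forall i, scale_set (l i) C (y i)) ->
  scale_set (\sum_i l i) C (\sum_i y i).
Proof.
move=> [c Cc] l_ge0 yl; elim: (index_enum I) => [|i s IH].
  by rewrite !big_nil; exists c => //; rewrite scale0r.
by rewrite !big_cons; apply: scale_set_add => //; exact: sumr_ge0.
Qed.

End ScaleSet.

(** * The lifted relaxation attached to a matrix of generators *)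

Section Relaxation.
Context (R : realType).

Lemma le_opt (V W : Type) (Q' : problem R V) (Q : problem R W) :
  relaxes Q' Q -> (opt Q' <= opt Q)%E.
Proof.
move=> rel; apply: le_ereal_inf_tmp => _ [w Qw <-].
have [v Qv le_vw] := rel w Qw.
by apply: ereal_inf_le; exists (objective Q' v)%:E; [exists v | rewrite lee_fin].
Qed.

End Relaxation.

Section Lifted.
Context (R : realType) (n ny : nat).
Variables (C : set 'cV[R]_ny) (f : 'cV[R]_n * 'cV[R]_ny -> R).

(** The relaxation with one multiplier [lambda i 0] and one scaled copy
    [col i Y] of y for each column of [M]; the problem [uDDR A b C f k] is
    [lifted (Rk A b k)] by definition. *)
Definition lifted p (M : 'M[R]_(1 + n, p)) :
    problem R ('cV[R]_n * 'M[R]_(ny, p) * 'cV[R]_p) :=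
  Problem
    [set v : 'cV[R]_n * 'M[R]_(ny, p) * 'cV[R]_p |
      let: (x, Y, lambda) := v in
      (forall i, scale_set (lambda i 0) C (col i Y) /\ 0 <= lambda i 0) /\
      M *m lambda = homog x]
    (fun v => let: (x, Y, lambda) := v in
      \sum_i homogenization f
        (lambda i 0 *: dsubmx (col i M)) (col i Y) (lambda i 0)).

Lemma homogenizationE (x : 'cV[R]_n) (y : 'cV[R]_ny) (l : R) :
  homogenization f (l *: x) y l = persp (fun z => f (x, z)) y l.
Proof.
rewrite /homogenization /persp; case: ifP => // l0.
by rewrite scalerA mulVf ?scale1r // gt_eqF.
Qed.

Lemma objective_lifted p (M : 'M[R]_(1 + n, p)) x Y lambda :
  objective (lifted M) (x, Y, lambda) =
  \sum_i persp (fun z => f (dsubmx (col i M), z)) (col i Y) (lambda i 0).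
Proof. by apply: eq_bigr => i _; rewrite homogenizationE. Qed.

Lemma mulmx_sum_cols p (M : 'M[R]_(1 + n, p)) (lambda : 'cV[R]_p) :
  M *m lambda = \sum_i lambda i 0 *: col i M.
Proof.
apply/matrixP=> i j; rewrite summxE !mxE; apply: eq_bigr => k _.
by rewrite !mxE ord1 mulrC.
Qed.

Lemma dsubmx_sum p (M : 'M[R]_(1 + n, p)) (lambda : 'cV[R]_p) :
  dsubmx (M *m lambda) = \sum_i lambda i 0 *: dsubmx (col i M).
Proof.
by rewrite mulmx_sum_cols linear_sum; apply: eq_bigr => i _; rewrite linearZ.
Qed.

Lemma homog0 (x : 'cV[R]_n) : homog x 0 0 = 1.
Proof.
have <- : lshift n 0 = 0 :> 'I_(1 + n) by apply: val_inj.
by rewrite /homog col_mxEu mxE eqxx.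
Qed.

Lemma homogK (z : 'cV[R]_(1 + n)) : z 0 0 = 1 -> homog (dsubmx z) = z.
Proof.
move=> z0; rewrite -[RHS]vsubmxK; congr col_mx; apply/matrixP=> i j.
rewrite !mxE !ord1 eqxx -z0; congr (z _ _); exact: val_inj.
Qed.

Lemma sum_weights p (M : 'M[R]_(1 + n, p)) (lambda : 'cV[R]_p) x :
  (forall i, M 0 i = 1) -> M *m lambda = homog x -> \sum_i lambda i 0 = 1.
Proof.
move=> M0 Mx; rewrite -(homog0 x) -Mx mxE.
by apply: eq_bigr => i _; rewrite M0 mul1r.
Qed.

Hypothesis C_neq0 : C !=set0.
Hypothesis C_convex : convex_set C.
Hypothesis f_concave : forall y, convex_function setT (fun x => - f (x, y)).
Hypothesis f_convex : forall x, convex_function setT (fun y => f (x, y)).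

Lemma concave_jensen (I : finType) (w : I -> R) (x : I -> 'cV[R]_n) y :
  (forall i, 0 <= w i) -> \sum_i w i = 1 ->
  \sum_i w i * f (x i, y) <= f (\sum_i w i *: x i, y).
Proof.
move=> w0 w1; rewrite -lerN2 -sumrN.
under [leRHS]eq_bigr do rewrite -mulrN.
exact: (jensen x (f_concave y)).
Qed.

Lemma lifted_convex p (M : 'M[R]_(1 + n, p)) : convex_problem (lifted M).
Proof.
split.
  move=> [[x1 Y1] l1] [[x2 Y2] l2] t; rewrite !inE /= => -[F1 E1] [F2 E2].
  have [t0 t1] : 0 <= t%:num /\ 0 <= 1 - t%:num by rewrite subr_ge0.
  split=> [i|].
    have [C1 l1_ge0] := F1 i; have [C2 l2_ge0] := F2 i.
    rewrite !mxE linearD !linearZ /=; split.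
      apply: scale_set_add => //; rewrite ?mulr_ge0 //; exact: scale_setZ.
    by rewrite addr_ge0 ?mulr_ge0.
  rewrite mulmxDr -!scalemxAr E1 E2 /homog !scale_col_mx add_col_mx.
  congr col_mx; apply/matrixP=> i j; rewrite !mxE -mulrDl.
  by rewrite addrC subrK mul1r.
move=> t [[x1 Y1] l1] [[x2 Y2] l2]; rewrite !inE /= => -[F1 E1] [F2 E2].
have [t0 t1] : 0 <= t%:num /\ 0 <= 1 - t%:num by rewrite subr_ge0.
rewrite !convRE.
(* A convex combination of triples is computed componentwise. *)
change (objective (lifted M) (t%:num *: x1 + (1 - t%:num) *: x2,
    t%:num *: Y1 + (1 - t%:num) *: Y2, t%:num *: l1 + (1 - t%:num) *: l2) <=
  t%:num * objective (lifted M) (x1, Y1, l1)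
  + (1 - t%:num) * objective (lifted M) (x2, Y2, l2)).
rewrite !objective_lifted !mulr_sumr -big_split /=; apply: ler_sum => i _.
have [C1 l1_ge0] := F1 i; have [C2 l2_ge0] := F2 i.
rewrite !mxE linearD !linearZ /= -!perspZ //.
apply: persp_add => //; apply: (@scale_set_dom _ _ C);
  rewrite ?mulr_ge0 //;
  exact: scale_setZ.
Qed.

(** If the columns of [M *m W] are convex combinations of those of [M], then
    [(x, Y, lambda)] feasible for [M *m W] gives [(x, Y *m W^T, W *m lambda)]
    feasible for [M]. *)
Lemma lifted_refine p q (M : 'M[R]_(1 + n, p)) (W : 'M[R]_(p, q)) :
  (forall i, M 0 i = 1) -> (forall j, (M *m W) 0 j = 1) ->
  (forall i j, 0 <= W i j) -> relaxes (lifted M) (lifted (M *m W)).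
Proof.
move=> M0 MW0 W0 [[x Y] lambda] /= [F E].
have l0 i : 0 <= lambda i 0 by case: (F i).
have W1 j : \sum_i W i j = 1.
  by rewrite -(MW0 j) mxE; apply: eq_bigr => i _; rewrite M0 mul1r.
have YE i : col i (Y *m W^T) = \sum_j W i j *: col j Y.
  apply/matrixP=> a c; rewrite summxE !mxE; apply: eq_bigr => j _.
  by rewrite !mxE mulrC.
have lE i : (W *m lambda) i 0 = \sum_j W i j * lambda j 0 by rewrite mxE.
exists (x, Y *m W^T, W *m lambda).
  split=> [i|]; last by rewrite mulmxA.
  rewrite YE lE; split; last by apply: sumr_ge0 => j _; rewrite mulr_ge0.
  apply: scale_set_sum => // j; first by rewrite mulr_ge0.
  by apply: scale_setZ; case: (F j).
change (objective (lifted M) (x, Y *m W^T, W *m lambda) <=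
  objective (lifted (M *m W)) (x, Y, lambda)).
rewrite !objective_lifted.
(* Convexity in y bounds the aggregated perspectives by this double sum;
   concavity in x, applied after exchanging the sums, bounds the double sum. *)
apply: (@le_trans _ _ (\sum_i \sum_j
    W i j * persp (fun z => f (dsubmx (col i M), z)) (col j Y) (lambda j 0))).
  apply: ler_sum => i _; rewrite YE lE.
  under [leRHS]eq_bigr do rewrite -perspZ //.
  apply: persp_sum => // j.
  apply: (@scale_set_dom _ _ C); last exact: mulr_ge0.
  by apply: scale_setZ; case: (F j).
rewrite exchange_big /=; apply: ler_sum => j _.
rewrite /persp; case: ifP => [lj|_]; last by rewrite big1 // => i _; rewrite mulr0.
under eq_bigr do rewrite mulrCA.
rewrite -mulr_sumr ler_pM2l //.
have -> : dsubmx (col j (M *m W)) = \sum_i W i j *: dsubmx (col i M).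
  rewrite colE -mulmxA -colE dsubmx_sum; apply: eq_bigr => i _; by rewrite mxE.
exact: concave_jensen.
Qed.

(** If the columns of [M] represent points of [P], then some term with a
    positive weight is at most the weighted mean which is the objective; it
    provides a point of [P] and a point of [C]. *)
Lemma lifted_exact p (P : set 'cV[R]_n) (M : 'M[R]_(1 + n, p)) :
  (forall i, M 0 i = 1) -> (forall i, P (dsubmx (col i M))) ->
  relaxes (Problem [set xy | C xy.2 /\ P xy.1] f) (lifted M).
Proof.
move=> M0 PM [[x Y] lambda] /= [F E].
have l0 i : 0 <= lambda i 0 by case: (F i).
have l1 := sum_weights M0 E.
set obj := \sum_i _.
have [i li le_i] : exists2 i, 0 < lambda i 0 &
    f (dsubmx (col i M), (lambda i 0)^-1 *: col i Y) <= obj.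
  apply: contrapT => none; suff : obj < obj by rewrite ltxx.
  (* Otherwise the weighted mean obj would exceed itself. *)
  have objE : obj = \sum_i lambda i 0 * obj by rewrite -mulr_suml l1 mul1r.
  have gt_obj i : 0 < lambda i 0 ->
      obj < f (dsubmx (col i M), (lambda i 0)^-1 *: col i Y).
    by move=> li; rewrite ltNge; apply/negP => le_i; apply: none; exists i.
  have l_eq0 i : ~ 0 < lambda i 0 -> lambda i 0 = 0.
    by move=> /negP; rewrite -leNgt => li; apply/le_anti; rewrite li l0.
  have [i0 li0] : exists i, 0 < lambda i 0.
    apply: contrapT => no; have := oner_neq0 R; rewrite -l1 big1 ?eqxx // => i _.
    by apply: l_eq0 => li; apply: no; exists i.
  rewrite {1}objE [in ltRHS]/obj.
  have term i : lambda i 0 * obj <= homogenization f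
      (lambda i 0 *: dsubmx (col i M)) (col i Y) (lambda i 0).
    rewrite homogenizationE /persp; case: ifP => [li|/negP/l_eq0->].
      by rewrite ler_pM2l // ltW // gt_obj.
    by rewrite mul0r.
  rewrite (bigD1 i0) //= [ltRHS](bigD1 i0) //= ltr_leD ?ler_sum //.
  by rewrite homogenizationE /persp li0 ltr_pM2l // gt_obj.
exists (dsubmx (col i M), (lambda i 0)^-1 *: col i Y) => //.
split; last exact: PM.
have [[c Cc <-] _] := F i.
by rewrite /= scalerA mulVf ?scale1r // gt_eqF.
Qed.

End Lifted.

(** * The invariant of the double description algorithm *)

Section DoubleDescriptionPair.
Context (R : realType) (n : nat).
Implicit Types (a h : 'rV[R]_(1 + n)) (z v : 'cV[R]_(1 + n)).
Implicit Types (H : set 'rV[R]_(1 + n)) (g l r : generator R n) (s : dd_state R n).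

Lemma rowdot_e0 v : rowdot (delta_mx 0 0) v = v 0 0.
Proof. by rewrite /rowdot -rowE mxE. Qed.

Lemma rowdotD a v1 v2 : rowdot a (v1 + v2) = rowdot a v1 + rowdot a v2.
Proof. by rewrite /rowdot mulmxDr mxE. Qed.

Lemma rowdotZ a c v : rowdot a (c *: v) = c * rowdot a v.
Proof. by rewrite /rowdot -scalemxAr mxE. Qed.

Lemma rowdotN a v : rowdot a (- v) = - rowdot a v.
Proof. by rewrite /rowdot mulmxN mxE. Qed.

Lemma rowdot_sum a (I : Type) (t : seq I) (P : pred I) (F : I -> 'cV[R]_(1 + n)) :
  rowdot a (\sum_(i <- t | P i) F i) = \sum_(i <- t | P i) rowdot a (F i).
Proof. by rewrite /rowdot mulmx_sumr summxE. Qed.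

(** The cone of the vectors on which all functionals of [H] are nonnegative. *)
Definition dual_cone H : set 'cV[R]_(1 + n) :=
  [set z | forall h, H h -> 0 <= rowdot h z].

(** The value at [z] of the combination of the vectors of [t] with their own
    coefficient functions. *)
Definition gen_sum (t : seq (generator R n)) z : 'cV[R]_(1 + n) :=
  \sum_(g <- t) g.2 z *: g.1.

(** The pair [s] describes the cone of [H]. Strict positivity of some functional
    keeps rays nonzero, even modulo the lines; minimality of the rays and linear
    independence of the lines play no role. *)
Record dd_valid H s : Prop := DDValid {
  lines_orth : forall l, l \in lines s -> forall h, H h -> rowdot h l.1 = 0;
  rays_cone : forall r, r \in rays s -> dual_cone H r.1;
  rays_pos : forall r, r \in rays s -> exists2 h, H h & 0 < rowdot h r.1;
  mu_ge0 : forall z, dual_cone H z -> forall r, r \in rays s -> 0 <= r.2 z;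
  decomp : forall z, dual_cone H z ->
    gen_sum (lines s) z + gen_sum (rays s) z = z }.

Lemma dual_cone_add H a z :
  dual_cone (a |` H) z <-> 0 <= rowdot a z /\ dual_cone H z.
Proof.
split=> [K|[az K] h [->|/K]] //.
by split=> [|h Hh]; apply: K; [left | right].
Qed.

(** The sign of [b r] splits a sum over [t] in three. *)
Lemma big_sign (V : nmodType) (t : seq (generator R n)) (b : generator R n -> R)
    (F : generator R n -> V) :
  \sum_(r <- t) F r = \sum_(r <- [seq r <- t | b r == 0%R]) F r
    + (\sum_(r <- [seq r <- t | 0 < b r]) F r
       + \sum_(r <- [seq r <- t | b r < 0]) F r).
Proof.
rewrite !big_filter.
elim: t => [|r t IH]; first by rewrite !big_nil !addr0.
rewrite !big_cons IH; case: (ltrgtP (b r) 0) => _.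
- by rewrite [X in _ = _ + X]addrCA [RHS]addrCA.
- by rewrite -[X in _ = _ + X]addrA [RHS]addrCA.
- by rewrite addrA.
Qed.

(** Each ray produced by Case 2 is a nonnegative combination of two old rays
    (equal ones for a kept ray) and satisfies the new constraint. *)
Lemma case2_raysP a ls t r : r \in rays (dd_case2 a ls t) ->
  0 <= rowdot a r.1 /\
  exists r1 r2 c1 c2, [/\ r1 \in t, r2 \in t, 0 < c1, 0 <= c2 &
    r.1 = c1 *: r1.1 + c2 *: r2.1].
Proof.
rewrite /= !mem_cat => /or3P[].
- rewrite mem_filter => /andP[/eqP-> rt]; split=> //.
  by exists r, r, 1, 0; rewrite scale1r scale0r addr0.
- case/mapP=> i; rewrite mem_filter => /andP[/ltW a_i it] ->; split=> //.
  by exists i, i, 1, 0; rewrite scale1r scale0r addr0.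
- case/allpairsP=> -[i j] /=; rewrite !mem_filter.
  move=> [/andP[a_i it] /andP[a_j jt] ->] /=; split.
    by rewrite rowdotD rowdotN !rowdotZ [X in _ - X]mulrC subrr.
  exists j, i, (rowdot a i.1), (- rowdot a j.1).
  by split; rewrite ?scaleNr // oppr_ge0 ltW.
Qed.

(** A ray of the new cone keeps a strictly positive constraint, because no
    constraint of the old cone is negative on either of its two parents. *)
Lemma case2_valid H a s : (forall l, l \in lines s -> rowdot a l.1 = 0) ->
  dd_valid H s -> dd_valid (a |` H) (dd_case2 a (lines s) (rays s)).
Proof.
move=> a0 [lin cone pos mu0 dec].
pose Np := [seq r <- rays s | 0 < rowdot a r.1].
pose Nm := [seq r <- rays s | rowdot a r.1 < 0].
pose T z := \sum_(i <- Np) i.2 z * rowdot a i.1.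
pose D z := \sum_(j <- Nm) j.2 z * rowdot a j.1.
have T_ge0 z : dual_cone H z -> 0 <= T z.
  move=> Kz; rewrite /T big_filter big_seq_cond sumr_ge0 // => r /andP[rs ar].
  by rewrite mulr_ge0 ?(mu0 z) // ltW.
(* The lines and the rays orthogonal to a do not contribute. *)
have azE z : dual_cone H z -> rowdot a z = T z + D z.
  move=> Kz; rewrite -[in LHS](dec z Kz) rowdotD /gen_sum !rowdot_sum.
  rewrite [X in X + _]big_seq big1 ?add0r => [|l ls]; last first.
    by rewrite rowdotZ a0 ?mulr0.
  rewrite (big_sign _ (fun r => rowdot a r.1)) [X in X + _]big_filter.
  rewrite [X in X + _]big1 ?add0r => [|r /eqP ar]; last by rewrite rowdotZ ar mulr0.
  by congr (_ + _); apply: eq_bigr => r _; rewrite rowdotZ.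
split.
- by move=> l ls h [->|Hh]; [exact: a0 | exact: lin].
- move=> r /case2_raysP[ar [r1 [r2 [c1 [c2 [r1s r2s c1_gt0 c2_ge0 rE]]]]]].
  move=> h [-> //|Hh]; rewrite rE rowdotD !rowdotZ.
  by rewrite addr_ge0 // mulr_ge0 ?(ltW c1_gt0) // cone.
- move=> r /case2_raysP[ar [r1 [r2 [c1 [c2 [r1s r2s c1_gt0 c2_ge0 rE]]]]]].
  have [h Hh h_gt0] := pos _ r1s; exists h; first by right.
  by rewrite rE rowdotD !rowdotZ ltr_wpDr ?mulr_gt0 ?mulr_ge0 ?cone.
- move=> z /dual_cone_add[az Kz] r; have mu_z := mu0 z Kz.
  rewrite /= -/Np -/Nm !mem_cat => /or3P[].
  + by rewrite mem_filter => /andP[_ rs]; exact: mu_z.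
  + case/mapP=> i; rewrite mem_filter => /andP[_ it] -> /=; rewrite -/(T z).
    have [T0|Tn0] := eqVneq (T z) 0.
      by rewrite big1 ?addr0 ?mu_z // => j _; rewrite T0 invr0 mulr0.
    have -> : \sum_(j <- Nm) j.2 z * i.2 z * rowdot a j.1 / T z
        = i.2 z * D z / T z.
      by rewrite mulr_sumr mulr_suml; apply: eq_bigr => j _; ring.
    have -> : i.2 z + i.2 z * D z / T z = i.2 z * (T z + D z) / T z by field.
    by rewrite -azE // !mulr_ge0 ?mu_z // invr_ge0 T_ge0.
  + case/allpairsP=> -[i j] /= []; rewrite !mem_filter.
    move=> /andP[_ it] /andP[_ jt] -> /=; rewrite -/(T z).
    by rewrite !mulr_ge0 ?mu_z // invr_ge0 T_ge0.
- move=> z /dual_cone_add[az Kz]; have mu_z := mu0 z Kz.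
  rewrite -[RHS](dec z Kz) /= -/Np -/Nm; congr (_ + _).
  rewrite /gen_sum [RHS](big_sign _ (fun r => rowdot a r.1)) !big_cat /=.
  congr (_ + _); rewrite big_map big_allpairs_dep /= -/(T z) -big_split /=.
  transitivity (\sum_(i <- Np) (i.2 z *: i.1
      + \sum_(j <- Nm) (i.2 z * rowdot a i.1 * (j.2 z / T z)) *: j.1)).
    apply: eq_bigr => i _; rewrite scalerDl scaler_suml -addrA; congr (_ + _).
    rewrite -big_split /=; apply: eq_bigr => j _.
    rewrite scalerBr !scalerA addrCA -[RHS]addr0; congr (_ + _).
      by congr (_ *: _); ring.
    by rewrite -scalerBl [X in X *: _](_ : _ = 0) ?scale0r //; ring.
  rewrite big_split exchange_big /=; congr (_ + _).
  rewrite [LHS]big_seq [RHS]big_seq; apply: eq_bigr => j jm.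
  rewrite -scaler_suml -mulr_suml -/(T z); congr (_ *: _).
  have [T0|Tn0] := eqVneq (T z) 0; last by rewrite mulrCA divff ?mulr1.
  (* If T z = 0, then D z >= 0 although its summands are <= 0, so the weights
     of the discarded rays vanish. *)
  rewrite T0 mul0r; apply/esym/eqP; move: jm; rewrite mem_filter => /andP[a_j jt].
  have := az; rewrite azE // T0 add0r -oppr_le0 -sumrN => D_le0.
  have D_ge0 r : r \in Nm -> 0 <= - (r.2 z * rowdot a r.1).
    rewrite mem_filter => /andP[ar rs].
    by rewrite oppr_ge0 mulr_ge0_le0 ?mu_z // ltW.
  have : \sum_(r <- Nm | r \in Nm) - (r.2 z * rowdot a r.1) == 0.
    by rewrite eq_le sumr_ge0 // -big_seq D_le0.
  rewrite psumr_eq0 // => /allP/(_ j).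
  rewrite mem_filter a_j jt => /(_ isT)/implyP/(_ isT).
  by rewrite oppr_eq0 mulf_eq0 [X in _ || X]lt_eqF ?orbF.
Qed.

(** The first new weight is the value of the new constraint divided by
    [al > 0]. The lines of [post] and the old rays are replaced by [al] times
    their projections onto the kernel of [a] along [g.1]; as the old constraints
    vanish on [g.1], this multiplies their values by [al]. *)
Lemma case1_valid H a s pre g0 post : lines s = pre ++ g0 :: post ->
  (forall l, l \in pre -> rowdot a l.1 = 0) -> rowdot a g0.1 != 0 ->
  dd_valid H s -> dd_valid (a |` H) (dd_case1 a pre g0 post (rays s)).
Proof.
move=> linesE pre0 g0_neq0 [lin cone pos mu0 dec]; rewrite /dd_case1.
set g : generator R n := if _ then _ else _; set al := rowdot a g.1.
have g0s : g0 \in lines s by rewrite linesE mem_cat mem_head orbT.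
have al_gt0 : 0 < al.
  rewrite /al /g; case: (ltrgtP (rowdot a g0.1) 0) g0_neq0 => //= a_g0 _.
  by rewrite rowdotN oppr_gt0.
have aln0 : al != 0 by rewrite gt_eqF.
have gE z : g.2 z *: g.1 = g0.2 z *: g0.1.
  by rewrite /g; case: ifP => //= _; rewrite scalerN scaleNr opprK.
have gH h : H h -> rowdot h g.1 = 0.
  by move=> Hh; rewrite /g; case: ifP => _ /=; rewrite ?rowdotN lin ?oppr0.
have elim_a v : rowdot a (al *: v - rowdot a v *: g.1) = 0.
  by rewrite rowdotD rowdotN !rowdotZ mulrC subrr.
have elim_h h v : H h -> rowdot h (al *: v - rowdot a v *: g.1) = al * rowdot h v.
  by move=> Hh; rewrite rowdotD rowdotN !rowdotZ gH // mulr0 subr0.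
have post_s l : l \in post -> l \in lines s.
  by rewrite linesE mem_cat inE => ->; rewrite !orbT.
pose th z := g.2 z + \sum_(h <- post) rowdot a h.1 * h.2 z / al
  + \sum_(r <- rays s) rowdot a r.1 * r.2 z / al.
(* The lines before g0 are in the kernel of a, so they do not contribute. *)
have azE z : dual_cone H z -> rowdot a z = al * th z.
  move=> Kz; rewrite -[in LHS](dec z Kz) linesE /gen_sum big_cat big_cons /= -gE.
  rewrite !rowdotD rowdotZ !rowdot_sum [X in X + _ + _]big_seq.
  rewrite big1 ?add0r => [|l lpre].
    rewrite /th !mulrDr -/al [al * _]mulrC !mulr_sumr; congr (_ + _ + _);
    by apply: eq_bigr => l _; rewrite rowdotZ mulrC mulrCA divff ?mulr1.
  by rewrite rowdotZ pre0 ?mulr0.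
split=> /=.
- move=> l; rewrite mem_cat => /orP[lpre|/mapP[l' l's ->]] h [->|Hh] /=.
  + exact: pre0.
  + by apply: lin => //; rewrite linesE mem_cat lpre.
  + exact: elim_a.
  + by rewrite elim_h // lin ?mulr0 // post_s.
- move=> r; rewrite inE => /orP[/eqP->|/mapP[r' r's ->]] h [->|Hh] /=.
  + exact: ltW.
  + by rewrite gH.
  + by rewrite elim_a.
  + by rewrite elim_h // mulr_ge0 ?(ltW al_gt0) // cone.
- move=> r; rewrite inE => /orP[/eqP->|/mapP[r' r's ->]] /=.
    by exists a => //; left.
  have [h Hh h_gt0] := pos _ r's; exists h; first by right.
  by rewrite elim_h // mulr_gt0.
- move=> z /dual_cone_add[az Kz] r; rewrite inE => /orP[/eqP->|/mapP[r' r's ->]] /=.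
    by rewrite -/(th z) -(pmulr_rge0 _ al_gt0) -azE.
  by rewrite mulr_ge0 ?mu0 // invr_ge0 ltW.
- move=> z /dual_cone_add[az Kz]; rewrite -[RHS](dec z Kz) linesE /gen_sum.
  rewrite !big_cat !big_cons !big_map /= -gE -/(th z).
  have sumE (t : seq (generator R n)) :
      \sum_(h <- t) (h.2 z / al) *: (al *: h.1 - rowdot a h.1 *: g.1) =
      \sum_(h <- t) h.2 z *: h.1 - (\sum_(h <- t) rowdot a h.1 * h.2 z / al) *: g.1.
    rewrite scaler_suml -sumrB; apply: eq_bigr => h _.
    rewrite scalerBr !scalerA; congr (_ *: _ - _ *: _); first by field.
    by rewrite mulrC mulrA.
  rewrite !sumE -!addrA; congr (_ + _); rewrite /th !scalerDl.
  set u := _ *: g.1; set v1 := _ *: g.1; set v2 := _ *: g.1.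
  set w1 := \sum_(h <- post) _; set w2 := \sum_(h <- rays s) _.
  apply/matrixP=> i j; rewrite !mxE; ring.
Qed.

Lemma dd_valid_step H a s : dd_valid H s -> dd_valid (a |` H) (dd_step a s).
Proof.
move=> V; rewrite /dd_step; set p := fun h : generator R n => _.
set xi := find _ _.
have pre0 l : l \in take xi (lines s) -> rowdot a l.1 = 0.
  move=> lpre; apply/eqP/negPn/negP => al.
  have ps : has p (lines s) by apply/hasP; exists l => //; exact: mem_take lpre.
  have := has_take xi ps; rewrite ltnn => /negbT/hasPn/(_ _ lpre).
  by rewrite /p al.
case E : (drop xi (lines s)) => [|g0 post].
  apply: case2_valid => // l ls; apply: pre0.
  by move: ls; rewrite -{1}(cat_take_drop xi (lines s)) E cats0.
apply: case1_valid => //; first by rewrite -E cat_take_drop.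
have lt_xi : (xi < size (lines s))%N.
  by rewrite ltnNge -subn_eq0 -size_drop E.
have := nth_find g0; rewrite -has_find in lt_xi.
move=> /(_ p _ lt_xi); rewrite -/xi -[X in nth _ _ X]addn0 -nth_drop E.
by [].
Qed.

(** The initial pair describes the half-space of the vectors with nonnegative
    coordinate 0. *)
Lemma dd_valid_init : dd_valid [set (delta_mx 0 0 : 'rV[R]_(1 + n))] (dd_init R n).
Proof.
have rs0 : rshift 1 _ = 0 :> 'I_(1 + n) -> False by move=> i [].
split=> /=.
- move=> l /mapP[i _ ->] h -> /=; rewrite rowdot_e0 mxE andbT.
  by case: eqP => // /esym/rs0.
- by move=> r; rewrite inE => /eqP-> h -> /=; rewrite rowdot_e0 mxE ler01.
- move=> r; rewrite inE => /eqP-> /=; exists (delta_mx 0 0) => //.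
  by rewrite rowdot_e0 mxE ltr01.
- by move=> z Kz r; rewrite inE => /eqP-> /=; rewrite -rowdot_e0 Kz.
- move=> z _; rewrite /gen_sum big_seq1 big_map /= big_enum /=.
  rewrite [RHS]matrix_sum_delta big_split_ord /= big_ord1 addrC.
  congr (_ + _); first by apply: eq_big => // i _; rewrite big_ord1.
  by rewrite big_ord1; congr (z _ _ *: delta_mx _ _); exact: val_inj.
Qed.

End DoubleDescriptionPair.

(** * Bounded sets *)

Section Bounded.
Context (R : realType).

(** A bounded set contains no half-line. *)
Lemma bounded_recession (V : normedModType R) (S : set V) (z v : V) :
  bounded_set S -> (forall t : R, 0 <= t -> S (z + t *: v)) -> v = 0.
Proof.
move=> [M [_ SM]] Szv; apply/eqP; rewrite -normr_eq0; apply: contraT => vn0.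
have v_gt0 : 0 < `|v| by rewrite lt_neqAle eq_sym vn0 /=.
have B (t : R) : 0 <= t -> t * `|v| <= M + 1 + `|z|.
  move=> t0; rewrite -[t in leLHS](ger0_norm t0) -normrZ.
  rewrite -[t *: v](addKr z) (le_trans (ler_normD _ _)) // normrN addrC lerD2r.
  by apply: SM; [rewrite ltrDl | exact: Szv].
have B0 : 0 <= M + 1 + `|z| by have := B 0 (lexx _); rewrite mul0r.
have := B ((M + 1 + `|z| + 1) / `|v|).
rewrite divfK // gerDl ler10; apply.
by rewrite divr_ge0 // addr_ge0.
Qed.

Lemma bounded_sub (V : normedModType R) (S T : set V) :
  S `<=` T -> bounded_set T -> bounded_set S.
Proof.
by move=> ST [M [Mr TM]]; exists M; split=> // B MB z /ST; exact: TM.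
Qed.

Lemma bounded_homog n (S : set 'cV[R]_n) (T : set 'cV[R]_(1 + n)) :
  bounded_set S -> (forall z, T z -> exists2 x, S x & z = homog x) ->
  bounded_set T.
Proof.
move=> [M [Mr SM]] TS; exists (Num.max M 1); split; first exact: num_real.
move=> B; rewrite gt_max => /andP[MB B1] z /TS[x Sx ->] /=.
rewrite /Num.norm /= mx_normrE; apply: bigmax_le => [|[i j] _ /=].
  by rewrite (le_trans _ (ltW B1)).
rewrite /homog; case: (split_ordP i) => k ->.
  by rewrite col_mxEu !mxE !ord1 eqxx normr1 ltW.
rewrite col_mxEd; apply: le_trans (SM B MB x Sx).
rewrite /Num.norm /= mx_normrE.
exact: (le_bigmax _ (fun ij : 'I_n * 'I_1 => `|x ij.1 ij.2|) (k, j)).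
Qed.

End Bounded.

(** * The double description run on a matrix of constraints *)

Section Run.
Context (R : realType) (m n : nat) (Ab : 'M[R]_(m, 1 + n)).

(** The functionals [z 0 0] and [row i Ab *m z] for [i < k], which cut out
    [dd_cone Ab k]. *)
Definition constraints k : set 'rV[R]_(1 + n) :=
  [set h | h = delta_mx 0 0 \/ exists2 i : 'I_m, (i < k)%N & h = row i Ab].

Lemma dual_cone_constraints k : dual_cone (constraints k) = dd_cone Ab k.
Proof.
have rowA (i : 'I_m) (z : 'cV[R]_(1 + n)) : rowdot (row i Ab) z = (Ab *m z) i 0.
  by rewrite /rowdot -row_mul mxE.
apply/seteqP; split=> z /=.
  move=> K; split=> [|i ik]; first by rewrite -rowdot_e0; apply: K; left.
  by rewrite -rowA; apply: K; right; exists i.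
by move=> [z0 K] h [->|[i ik ->]]; rewrite ?rowdot_e0 ?rowA //; exact: K.
Qed.

Lemma ddS k (km : (k < m)%N) :
  dd Ab k.+1 = dd_step (row (Ordinal km) Ab) (dd Ab k).
Proof.
rewrite /dd (take_nth (Ordinal km)) ?size_enum_ord // -cats1 foldl_cat /=.
by congr (dd_step (row _ _) _); apply: val_inj; rewrite /= nth_enum_ord.
Qed.

Lemma dd_validP k : (k <= m)%N -> dd_valid (constraints k) (dd Ab k).
Proof.
elim: k => [_|k IH km].
  have -> : constraints 0 = [set delta_mx 0 0].
    by apply/seteqP; split=> h /= => [[|[i]]|] //; left.
  by rewrite /dd take0; exact: dd_valid_init.
have -> : constraints k.+1 = row (Ordinal km) Ab |` constraints k.
  apply/seteqP; split=> h /=.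
    move=> [->|[i]]; first by right; left.
    rewrite ltnS leq_eqVlt => /predU1P[ik|ik] ->; last by right; right; exists i.
    by left; congr row; exact: val_inj.
  move=> [->|[->|[i ik ->]]]; [|by left|].
    by right; exists (Ordinal km).
  by right; exists i => //; exact: ltnW.
by rewrite ddS; apply: dd_valid_step; apply: IH; exact: ltnW.
Qed.

Lemma dd_step_lines0 (a : 'rV[R]_(1 + n)) (s : dd_state R n) :
  (forall l, l \in lines s -> l.1 = 0) ->
  dd_step a s = dd_case2 a (lines s) (rays s).
Proof.
move=> l0; rewrite /dd_step hasNfind ?drop_size //.
by apply/hasPn => l /l0->; rewrite /rowdot mulmx0 mxE eqxx.
Qed.

End Run.

(** * Bounded slices of the homogenized polytope *)

Section Slices.
Context (R : realType) (m n : nat) (A : 'M[R]_(m, n)) (b : 'cV[R]_m).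

Lemma AbarE x (i : 'I_m) : (Abar A b *m homog x) i 0 = b i 0 - (A *m x) i 0.
Proof.
rewrite /Abar /homog mul_row_col mulNmx mulmx1.
by rewrite !mxE.
Qed.

Lemma Pk_homog k x : polyhedron A b x -> Pk A b k (homog x).
Proof.
move=> Px; split; last exact: homog0.
split=> [|i _]; first by rewrite homog0.
by rewrite AbarE subr_ge0.
Qed.

Lemma Pk_polyhedron z : Pk A b m z -> polyhedron A b (dsubmx z).
Proof.
by move=> [[_ Kz] z0] i; rewrite -subr_ge0 -AbarE homogK // Kz.
Qed.

Lemma Pk_sub k k' : (k <= k')%N -> Pk A b k' `<=` Pk A b k.
Proof.
move=> kk' z [[z0 Kz] z1]; split=> //; split=> // i ik.
by apply: Kz; exact: leq_trans kk'.
Qed.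

Lemma first_bounded_exists :
  bounded_set (polyhedron A b) -> exists kbar, first_bounded A b kbar.
Proof.
move=> bP; have bm : bounded_set (Pk A b m).
  apply: bounded_homog bP _ => z Pz; exists (dsubmx z); first exact: Pk_polyhedron.
  by rewrite homogK //; case: Pz.
have ex : exists k, `[< bounded_set (Pk A b k) >] by exists m; apply/asboolP.
case: (ex_minnP ex) => k /asboolP bk min_k; exists k; split=> //.
  by apply: min_k; apply/asboolP.
by move=> j jk bj; have := min_k j; rewrite leqNgt jk => /(_ (asboolT bj)).
Qed.

(** In this section the polyhedron is nonempty and its slice of level [k] is
    bounded. *)
Section Level.
Variable k : nat.
Hypothesis km : (k <= m)%N.
Hypothesis P_neq0 : polyhedron A b !=set0.
Hypothesis Pk_bounded : bounded_set (Pk A b k).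
Let Ab := Abar A b.

Let valid := dd_validP Ab km.

(** A recession direction of the bounded slice is null. *)
Lemma recession0 v : dual_cone (constraints Ab k) v -> v 0 0 = 0 -> v = 0.
Proof.
rewrite dual_cone_constraints => -[_ Kv] v0; have [x Px] := P_neq0.
apply: (bounded_recession (z := homog x) Pk_bounded) => t t0.
have [[Hx0 Kx] x1] := Pk_homog k Px.
split; last by rewrite /= mxE x1 mxE v0 mulr0 addr0.
split=> [|i ik]; first by rewrite mxE [X in _ + X]mxE v0 mulr0 addr0.
by rewrite mulmxDr -scalemxAr mxE [X in _ + X]mxE addr_ge0 ?mulr_ge0 ?Kx ?Kv.
Qed.

Lemma lines0 l : l \in lines (dd Ab k) -> l.1 = 0.
Proof.
move=> ls; have lin := lines_orth valid ls.
apply: recession0 => [h Hh|]; first by rewrite lin.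
by rewrite -rowdot_e0 lin //; left.
Qed.

Lemma rays_gt0 r : r \in rays (dd Ab k) -> 0 < r.1 0 0.
Proof.
move=> rs; have Kr := rays_cone valid rs.
have : 0 <= r.1 0 0 by move: Kr; rewrite dual_cone_constraints => -[].
rewrite le_eqVlt => /predU1P[/esym/(recession0 Kr) r0|//].
by have [h _] := rays_pos valid rs; rewrite r0 /rowdot mulmx0 mxE ltxx.
Qed.

(** Column [j] of [Rk] and entry [j] of [muk], in terms of a ray before
    dehomogenization. *)
Lemma dd_outP j : exists r, [/\ r \in rays (dd Ab k),
  col j (Rk A b k) = (r.1 0 0)^-1 *: r.1 &
  forall x, muk A b k x j 0 = r.1 0 0 * r.2 (homog x)].
Proof.
have /mapP[r rs rE] := mem_tnth j (in_tuple (dd_out A b k)).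
exists r; have E : tnth (in_tuple (dd_out A b k)) j =
    ((r.1 0 0)^-1 *: r.1, fun z => r.1 0 0 * r.2 z).
  by rewrite rE /dehomogenize rays_gt0.
split=> // [|x]; last by rewrite mxE E.
by apply/matrixP=> i c; rewrite !mxE E /= !mxE ord1.
Qed.

Lemma Rk0 j : Rk A b k 0 j = 1.
Proof.
have [r [rs E _]] := dd_outP j.
have -> : Rk A b k 0 j = col j (Rk A b k) 0 0 by rewrite [RHS]mxE.
by rewrite E mxE mulVf // gt_eqF // rays_gt0.
Qed.

Lemma colRk_Pk j : Pk A b k (col j (Rk A b k)).
Proof.
have [r [rs E _]] := dd_outP j.
split; last by rewrite /= mxE Rk0.
rewrite -dual_cone_constraints E => h Hh.
by rewrite rowdotZ mulr_ge0 ?invr_ge0 ?(ltW (rays_gt0 rs)) // (rays_cone valid rs).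
Qed.

Lemma muk_ge0 x j : polyhedron A b x -> 0 <= muk A b k x j 0.
Proof.
move=> Px; have [r [rs _ ->]] := dd_outP j.
rewrite mulr_ge0 ?(ltW (rays_gt0 rs)) // (mu_ge0 valid) //.
by rewrite dual_cone_constraints; case: (Pk_homog k Px).
Qed.

Lemma Rk_muk x : polyhedron A b x -> Rk A b k *m muk A b k x = homog x.
Proof.
move=> Px; have Kx : dual_cone (constraints Ab k) (homog x).
  by rewrite dual_cone_constraints; case: (Pk_homog k Px).
rewrite -[RHS](decomp valid Kx) {1}/gen_sum [X in X + _]big_seq.
rewrite big1 => [|l /lines0->]; last by rewrite scaler0.
rewrite add0r mulmx_sum_cols.
transitivity (gen_sum (dd_out A b k) (homog x)).
  rewrite /gen_sum [RHS]big_tnth; apply: eq_bigr => j _.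
  by rewrite mxE; congr (_ *: _); apply/matrixP => i c; rewrite !mxE ord1.
rewrite /gen_sum big_map big_seq [RHS]big_seq; apply: eq_bigr => r rs.
rewrite /dehomogenize rays_gt0 //= scalerA mulrC mulrA mulVf ?mul1r //.
by rewrite gt_eqF // rays_gt0.
Qed.

(** Membership in the cone generated by the columns of [Rk]. *)
Definition conic v := exists2 w : 'cV[R]_(pk A b k),
  (forall i, 0 <= w i 0) & v = Rk A b k *m w.

Lemma conicD v1 v2 : conic v1 -> conic v2 -> conic (v1 + v2).
Proof.
move=> [w1 w1_ge0 ->] [w2 w2_ge0 ->]; exists (w1 + w2); last by rewrite mulmxDr.
by move=> i; rewrite mxE addr_ge0.
Qed.

Lemma conicZ c v : 0 <= c -> conic v -> conic (c *: v).
Proof.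
move=> c0 [w w_ge0 ->]; exists (c *: w); last by rewrite scalemxAr.
by move=> i; rewrite mxE mulr_ge0.
Qed.

Lemma conic_ray r : r \in rays (dd Ab k) -> conic r.1.
Proof.
move=> rs; have r0 := rays_gt0 rs.
have -> : r.1 = r.1 0 0 *: ((r.1 0 0)^-1 *: r.1).
  by rewrite scalerA divff ?scale1r // gt_eqF.
apply: conicZ; first exact: ltW.
have /tnthP[j jE] : dehomogenize r \in in_tuple (dd_out A b k) by exact: map_f.
exists (delta_mx j 0); first by move=> i; rewrite mxE; case: (_ && _).
rewrite -colE; apply/matrixP => i c; rewrite mxE [RHS]mxE [RHS]mxE -jE.
by rewrite /dehomogenize r0 /= mxE ord1.
Qed.

(** All lines are null, so iteration [k] falls in Case 2 and every new column is
    a nonnegative combination of two old ones. *)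
Lemma Rk_refine (km' : (k < m)%N) : exists2 W : 'M[R]_(pk A b k, pk A b k.+1),
  (forall i j, 0 <= W i j) & Rk A b k.+1 = Rk A b k *m W.
Proof.
have out_conic j : conic (col j (Rk A b k.+1)).
  have /mapP[r rs rE] := mem_tnth j (in_tuple (dd_out A b k.+1)).
  have -> : col j (Rk A b k.+1) = (dehomogenize r).1.
    by rewrite -rE; apply/matrixP=> i c; rewrite !mxE ord1.
  move: rs; rewrite (ddS _ km') (dd_step_lines0 _ lines0) => /case2_raysP[_].
  move=> [r1 [r2 [c1 [c2 [r1s r2s c1_gt0 c2_ge0 r1E]]]]].
  have cr : conic r.1.
    rewrite r1E; apply: conicD; apply: conicZ; rewrite ?(ltW c1_gt0) //;
    exact: conic_ray.
  rewrite /dehomogenize; case: ifP => //= r0.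
  by apply: conicZ => //; rewrite invr_ge0 ltW.
have [w wP] := @choice _ _ (fun j (w : 'cV[R]_(pk A b k)) =>
    (forall i, 0 <= w i 0) /\ col j (Rk A b k.+1) = Rk A b k *m w)
  (fun j => let: ex_intro2 w w0 jE := out_conic j in ex_intro _ w (conj w0 jE)).
exists (\matrix_(i, j) w j i 0) => [i j|].
  by rewrite mxE; have [] := wP j.
apply/matrixP => i j.
have -> : Rk A b k.+1 i j = (Rk A b k *m w j) i 0.
  by have [_ <-] := wP j; rewrite [RHS]mxE.
by rewrite [LHS]mxE [RHS]mxE; apply: eq_bigr => c _; congr (_ * _); rewrite mxE.
Qed.

End Level.
End Slices.

Theorem theorem1 (R : realType) (m n ny : nat)
    (A : 'M[R]_(m, n)) (b : 'cV[R]_m)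
    (C : set 'cV[R]_ny) (f : 'cV[R]_n * 'cV[R]_ny -> R)
    (C_neq0 : C !=set0) (C_compact : compact C) (C_convex : convex_set C)
    (P_neq0 : polyhedron A b !=set0) (P_bounded : bounded_set (polyhedron A b))
    (f_cont : continuous f)
    (f_concave : forall y, convex_function setT (fun x => - f (x, y)))
    (f_convex : forall x, convex_function setT (fun y => f (x, y))) :
  (exists kbar, first_bounded A b kbar) /\
  forall kbar, first_bounded A b kbar ->
    (forall k, (kbar <= k <= m)%N ->
      [/\ forall j, Rk A b k 0 j = 1,
          relaxes (DDR A b C f k) (problemD A b C f),
          convex_problem (uDDR A b C f k) &
          relaxes (uDDR A b C f k) (DDR A b C f k)]) /\
    (forall k, (kbar <= k < m)%N ->
      (opt (uDDR A b C f k) <= opt (uDDR A b C f k.+1))%E) /\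
    opt (uDDR A b C f m) = opt (problemD A b C f).
Proof.
split; first exact: first_bounded_exists.
move=> kbar [kbar_m kbar_bounded _].
have bounded_k k : (kbar <= k)%N -> bounded_set (Pk A b k).
  by move=> kk; exact: bounded_sub (Pk_sub kk) kbar_bounded.
have uDDR_DDR k : relaxes (uDDR A b C f k) (DDR A b C f k).
  move=> [x y] [F E].
  exists (x, \matrix_(i, j) (muk A b k x j 0 * y i 0), muk A b k x).
    split=> // i; have [Fi mu0] := F i; split=> //; congr (scale_set _ C _): Fi.
    by apply/matrixP=> c d; rewrite !mxE ord1.
  rewrite le_eqVlt; apply/orP; left; apply/eqP; apply: eq_bigr => i _.
  by congr homogenization; apply/matrixP=> c d; rewrite !mxE ord1.
have DDR_D k : (kbar <= k <= m)%N -> relaxes (DDR A b C f k) (problemD A b C f).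
  move=> /andP[/bounded_k bk km] [x y] /= [Cy Px]; exists (x, y) => /=.
    split=> [i|]; last exact: Rk_muk.
    by split; [exists y | exact: muk_ge0].
  under eq_bigr => i _ do rewrite homogenizationE persp_line ?muk_ge0 //.
  have E := Rk_muk km P_neq0 bk Px.
  have xE : x = \sum_i muk A b k x i 0 *: dsubmx (col i (Rk A b k)).
    by rewrite -dsubmx_sum E /homog col_mxKd.
  rewrite [X in _ <= f (X, _)]xE; apply: concave_jensen => // [i|].
    exact: muk_ge0.
  by apply: sum_weights E => i; exact: Rk0.
split=> [k kk|].
  have /andP[/bounded_k bk km] := kk.
  split=> //; [exact: Rk0 | exact: DDR_D |].
  exact: (lifted_convex C_convex f_convex (Rk A b k)).
split=> [k /andP[kk km]|].
  have [W W0 RW] := Rk_refine (ltnW km) P_neq0 (bounded_k _ kk) km.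
  apply: le_opt; rewrite -[uDDR _ _ _ _ k]/(lifted C f (Rk A b k)).
  rewrite -[uDDR _ _ _ _ _]/(lifted C f (Rk A b k.+1)) RW.
  apply: lifted_refine => //; first exact: (Rk0 (ltnW km) P_neq0 (bounded_k _ kk)).
  by rewrite -RW; apply: Rk0 => //; apply: bounded_k; exact: leqW.
have mm : (kbar <= m <= m)%N by rewrite kbar_m leqnn.
apply/le_anti/andP; split.
  by apply: le_trans (le_opt (DDR_D _ mm)); exact: le_opt.
have bm := bounded_k _ kbar_m.
apply: le_opt; apply: lifted_exact => i; first exact: Rk0.
by apply: Pk_polyhedron; exact: colRk_Pk.
Qed.
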